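(* Let $\Phi$ be a flow on a closed hyperbolic $3$-manifold $M$, with lift $\widetilde\Phi$ to the universal cover $\mathbf H^3$. Suppose that: (a) each half orbit of $\widetilde\Phi$ has a unique limit point in $S^2_\infty$, that is, for every $x\in\mathbf H^3$ the limits $\eta_+(x)=\lim_{t\to+\infty}\widetilde\Phi_t(x)\in S^2_\infty$ and $\eta_-(x)=\lim_{t\to-\infty}\widetilde\Phi_t(x)\in S^2_\infty$ exist; (b) for a given orbit, the forward and backward limit points are distinct: $\eta_+(x)\ne\eta_-(x)$ for every $x\in\mathbf H^3$; (c) the forward and backward limit point maps $\eta_+,\eta_-:\mathbf H^3\to S^2_\infty$ are continuous. Then $\Phi$ is quasigeodesic.
   Context: $S^2_\infty$ is the sphere at infinity of $\mathbf H^3$; limits are taken in $\mathbf H^3\cup S^2_\infty\approx B^3$. Flows are continuous $\mathbf R$-actions generated by nonzero continuous vector fields. Flow lines of $\widetilde\Phi$ are parameterized by arc length, and $d$ is hyperbolic distance. $\Phi$ is *quasigeodesic* if there is $k\ge1$ such that for all $x\in\mathbf H^3$, $s,t\in\mathbf R$: $|t-s|\le k\,d(\widetilde\Phi_s(x),\widetilde\Phi_t(x))+k$. *)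

(* Defs.v *)
From HB Require Import structures.
From mathcomp Require Import all_boot all_order all_algebra.
From mathcomp Require Import all_classical all_reals all_analysis.

Set Implicit Arguments.
Unset Strict Implicit.
Unset Printing Implicit Defensive.

Import Order.TTheory GRing.Theory Num.Theory.
Import numFieldNormedType.Exports.

Local Open Scope classical_set_scope.
Local Open Scope ring_scope.

(* Poincare ball model of hyperbolic 3-space: H^3 is the
   open unit ball of R^3, the sphere at infinity is the unit sphere, and the
   compactification of H^3 is the closed ball with its Euclidean topology. *)

(* The library norm on row vectors is the sup norm (it induces the Euclidean
   topology, but is not the Euclidean length). *)
Definition enorm2 (R : realType) (v : 'rV[R]_3) : R := \sum_(i < 3) v 0 i ^+ 2.
Definition enorm (R : realType) (v : 'rV[R]_3) : R := Num.sqrt (enorm2 v).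

(* As types, these sets carry the subspace topology (subtype_topology). *)
Definition H3 (R : realType) : set 'rV[R]_3 := [set x | enorm x < 1].
Definition S2inf (R : realType) : set 'rV[R]_3 := [set x | enorm x = 1].
Arguments H3 R : clear implicits.
Arguments S2inf R : clear implicits.

Definition arcosh (R : realType) (u : R) : R := ln (u + Num.sqrt (u ^+ 2 - 1)).

Definition hdist (R : realType) (x y : H3 R) : R :=
  arcosh (1 + 2 * enorm2 (val x - val y) /
              ((1 - enorm2 (val x)) * (1 - enorm2 (val y)))).

(* Length of the vector v at x for the metric 4 |dx|^2 / (1 - |x|^2)^2, whose
   distance is hdist. *)
Definition hlength (R : realType) (x : H3 R) (v : 'rV[R]_3) : R :=
  2 * enorm v / (1 - enorm2 (val x)).

Definition hisometry (R : realType) (g : H3 R -> H3 R) : Prop :=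
  forall x y, hdist (g x) (g y) = hdist x y.

Record isometry_group (R : realType) (G : set (H3 R -> H3 R)) : Prop := {
  isometry_group_isom : forall g, G g -> hisometry g;
  isometry_group_id : G id;
  isometry_group_comp : forall g h, G g -> G h -> G (g \o h);
  isometry_group_inv : forall g, G g ->
    exists h, [/\ G h, cancel g h & cancel h g]
}.

Definition acts_freely (T : Type) (G : set (T -> T)) : Prop :=
  forall g x, G g -> g x = x -> g = id.

Definition acts_properly_discontinuously (T : topologicalType)
    (G : set (T -> T)) : Prop :=
  forall K : set T, compact K ->
    finite_set [set g | G g /\ (g @` K) `&` K !=set0].

(* M is the closed hyperbolic 3-manifold H^3 / G, with proj : H^3 -> M its
   universal covering and G = pi_1(M) acting by deck transformations. *)
Record closed_hyperbolic_3manifold (R : realType) (M : topologicalType)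
    (G : set (H3 R -> H3 R)) (proj : H3 R -> M) : Prop := {
  ch3_group : isometry_group G;
  ch3_free : acts_freely G;
  ch3_proper : acts_properly_discontinuously G;
  ch3_surj : forall m : M, exists x : H3 R, proj x = m;
  ch3_fiber : forall x y : H3 R, proj x = proj y <-> exists2 g, G g & g x = y;
  ch3_quotient : forall U : set M, open U <-> open (proj @^-1` U);
  ch3_compact : compact [set: M]
}.

Record continuous_action (R : realType) (T : topologicalType)
    (Phi : R -> T -> T) : Prop := {
  action_continuous : continuous (fun p : R * T => Phi p.1 p.2);
  action_0 : forall x, Phi 0 x = x;
  action_D : forall s t x, Phi (s + t) x = Phi s (Phi t x)
}.

(* g viewed as a map of R^3 (the identity outside the open ball), in order to
   differentiate it at points of the ball. *)
Definition extend (R : realType) (g : H3 R -> H3 R) (y : 'rV[R]_3) : 'rV[R]_3 :=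
  if insub y is Some x then val (g x) else y.

(* A continuous vector field on M = H^3 / G is a continuous vector field X on
   H^3 that is invariant under G: dg_x (X x) = X (g x). *)
Record continuous_vector_field_on_quotient (R : realType)
    (G : set (H3 R -> H3 R)) (X : H3 R -> 'rV[R]_3) : Prop := {
  vector_field_continuous : continuous X;
  vector_field_invariant : forall g, G g -> forall x : H3 R,
    is_derive (val x) (X x) (extend g) (X (g x))
}.

Definition generated_by (R : realType) (Phi : R -> H3 R -> H3 R)
    (X : H3 R -> 'rV[R]_3) : Prop :=
  forall (x : H3 R) (t : R),
    is_derive t 1 (fun s : R => val (Phi s x)) (X (Phi t x)).

(* tPhi is the lift to H^3 of the flow Phi on M = H^3 / G, and X is the lift of
   the nonzero continuous vector field on M that generates Phi. *)
Record flow_with_lift (R : realType) (M : topologicalType)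
    (G : set (H3 R -> H3 R)) (proj : H3 R -> M) (Phi : R -> M -> M)
    (tPhi : R -> H3 R -> H3 R) (X : H3 R -> 'rV[R]_3) : Prop := {
  flow_action : continuous_action Phi;
  flow_lift_action : continuous_action tPhi;
  flow_lift : forall t x, proj (tPhi t x) = Phi t (proj x);
  flow_field : continuous_vector_field_on_quotient G X;
  flow_field_neq0 : forall x, X x != 0;
  flow_generated : generated_by tPhi X
}.

Definition arc_length_parameterized (R : realType) (X : H3 R -> 'rV[R]_3) :
    Prop :=
  forall x : H3 R, hlength x (X x) = 1.

Definition quasigeodesic (R : realType) (tPhi : R -> H3 R -> H3 R) : Prop :=
  exists2 k : R, 1 <= k & forall (x : H3 R) (s t : R),
    `|t - s| <= k * hdist (tPhi s x) (tPhi t x) + k.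

(* Main.v *)
(* Let r(x) = |x - eta_-(x)|^2 / |x - eta_+(x)|^2 in the ball model.  Since eta_+
   and eta_- are constant along orbits and distinct, r is a positive continuous
   function that tends to infinity along every forward orbit.  The quotient
   r(Phi_t x) / r(x) is a boundary cross ratio; it is invariant under the deck
   group, as one sees by letting two points of an orbit in the cross ratio of
   four points run to the two ends of that orbit, and it is at most
   256 exp(4 d(x, Phi_t x)).  Cocompactness gives T0 and c such that every orbit
   has a jump of duration in [1, T0] that multiplies r by at least e, and r never
   drops by more than the factor c within time T0.  Hence r grows exponentially
   along orbits at a uniform rate, and d grows at least linearly. *)
Require Import Defs.
From mathcomp Require Import all_boot all_order all_algebra.
From mathcomp Require Import all_classical all_reals all_analysis.
From mathcomp Require Import ring lra.
Import Order.TTheory GRing.Theory Num.Theory.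
Import numFieldNormedType.Exports.
Local Open Scope classical_set_scope.
Local Open Scope ring_scope.

(** * Euclidean length on R^3 and continuity of its square *)

Section euclidean_norm.
Context {R : realType}.
Implicit Types u v w : 'rV[R]_3.

Lemma enorm2E v :
  enorm2 v = v 0 ord0 ^+ 2 + v 0 (lift ord0 ord0) ^+ 2
           + v 0 (lift ord0 (lift ord0 ord0)) ^+ 2.
Proof. by rewrite /enorm2 !big_ord_recl big_ord0 addr0 addrA. Qed.

Lemma enorm2_ge0 v : 0 <= enorm2 v.
Proof. by apply: sumr_ge0 => i _; exact: sqr_ge0. Qed.

Lemma enorm2_eq0 v : enorm2 v = 0 -> v = 0.
Proof.
move=> /eqP; rewrite psumr_eq0 => [/allP v0|i _]; last exact: sqr_ge0.
apply/rowP => i; rewrite mxE; apply/eqP; rewrite -sqrf_eq0.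
by apply: v0; rewrite mem_index_enum.
Qed.

Lemma enorm2_gt0 v : v != 0 -> 0 < enorm2 v.
Proof.
move=> v0; rewrite lt_neqAle enorm2_ge0 andbT eq_sym.
by apply: contra v0 => /eqP /enorm2_eq0 ->.
Qed.

Lemma enorm2_distC u v : enorm2 (u - v) = enorm2 (v - u).
Proof. by rewrite !enorm2E !mxE; ring. Qed.

Lemma enorm_ge0 v : 0 <= enorm v. Proof. exact: sqrtr_ge0. Qed.

Lemma enorm_distC u v : enorm (u - v) = enorm (v - u).
Proof. by rewrite /enorm enorm2_distC. Qed.

Lemma sqr_enorm v : enorm v ^+ 2 = enorm2 v.
Proof. by rewrite sqr_sqrtr // enorm2_ge0. Qed.

(** After squaring, the claim reduces to Cauchy-Schwarz for the dot product. *)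
Lemma enormD u v : enorm (u + v) <= enorm u + enorm v.
Proof.
rewrite -(@ler_pXn2r _ 2) ?nnegrE ?addr_ge0 ?enorm_ge0 //.
rewrite sqrrD !sqr_enorm.
set a := u 0 ord0; set b := u 0 (lift ord0 ord0).
set c := u 0 (lift ord0 (lift ord0 ord0)).
set a' := v 0 ord0; set b' := v 0 (lift ord0 ord0).
set c' := v 0 (lift ord0 (lift ord0 ord0)).
have dot_le : a * a' + b * b' + c * c' <= enorm u * enorm v.
  apply: le_trans (ler_norm _) _.
  rewrite -(@ler_pXn2r _ 2) ?nnegrE ?mulr_ge0 ?enorm_ge0 //.
  rewrite real_normK ?num_real // exprMn !sqr_enorm !enorm2E.
  rewrite -/a -/b -/c -/a' -/b' -/c' -subr_ge0.
  (* Lagrange's identity *)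
  have -> : (a ^+ 2 + b ^+ 2 + c ^+ 2) * (a' ^+ 2 + b' ^+ 2 + c' ^+ 2)
      - (a * a' + b * b' + c * c') ^+ 2
    = (a * b' - b * a') ^+ 2 + (a * c' - c * a') ^+ 2 + (b * c' - c * b') ^+ 2.
    by ring.
  by rewrite !addr_ge0 ?sqr_ge0.
have -> : enorm2 (u + v)
    = enorm2 u + (a * a' + b * b' + c * c') *+ 2 + enorm2 v.
  by rewrite !enorm2E !mxE -/a -/b -/c -/a' -/b' -/c'; ring.
by rewrite lerD2r lerD2l lerMn2r dot_le orbT.
Qed.

Lemma enormB_le u v w : enorm (u - w) <= enorm (u - v) + enorm (v - w).
Proof. by apply: le_trans (enormD _ _); rewrite addrA subrK. Qed.

Lemma enorm_le_dist u v : enorm u <= enorm (u - v) + enorm v.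
Proof. by have := enormD (u - v) v; rewrite subrK. Qed.

Lemma continuous_enorm2 : continuous (@enorm2 R).
Proof.
move=> v; rewrite /continuous_at enorm2E (funext enorm2E).
have sqr_cvg i : (fun w : 'rV[R]_3 => w 0 i ^+ 2) w @[w --> v] --> v 0 i ^+ 2.
  have coord : (fun w : 'rV[R]_3 => w 0 i) w @[w --> v] --> v 0 i.
    exact: (@coord_continuous R 1 3 0 i v).
  by apply: (@cvgM _ _ (nbhs v) _ _ _ _ _ coord coord).
apply: (@cvgD _ _ _ (nbhs v)); last exact: sqr_cvg.
by apply: (@cvgD _ _ _ (nbhs v)); exact: sqr_cvg.
Qed.

Lemma cvg_enorm2B {T : Type} {F : set_system T} {FF : Filter F}
    (f g : T -> 'rV[R]_3) (a b : 'rV[R]_3) :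
  f x @[x --> F] --> a -> g x @[x --> F] --> b ->
  enorm2 (f x - g x) @[x --> F] --> enorm2 (a - b).
Proof.
move=> fa gb; apply: (@continuous_cvg _ _ _ F FF (fun x => f x - g x)).
  exact: continuous_enorm2.
exact: (@cvgB R 'rV[R]_3).
Qed.

End euclidean_norm.

(** * Hyperbolic distance in the ball, compared with Euclidean distances to boundary points *)

Section hyperbolic_distance.
Context {R : realType}.
Implicit Types x y : H3 R.

Lemma H3_enorm x : enorm (val x) < 1.
Proof. exact: set_mem (valP x). Qed.

(** The hyperbolic metric at [x] is the Euclidean one scaled by [2 / conf x]. *)
Definition conf x : R := 1 - enorm2 (val x).

Lemma confE x : conf x = (1 - enorm (val x)) * (1 + enorm (val x)).
Proof. by rewrite /conf -sqr_enorm; ring. Qed.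

Lemma conf_gt0 x : 0 < conf x.
Proof.
by rewrite confE mulr_gt0 ?subr_gt0 ?H3_enorm // ltr_wpDr ?enorm_ge0.
Qed.

Lemma conf_le1 x : conf x <= 1.
Proof. by rewrite /conf gerBl enorm2_ge0. Qed.

(** This is sinh^2(d/2) for d = [hdist x y]: a rational substitute for the distance, preserved by
    isometries and free of [arcosh]. *)
Definition disp x y : R := enorm2 (val x - val y) / (conf x * conf y).

Lemma disp_ge0 x y : 0 <= disp x y.
Proof. by rewrite divr_ge0 ?enorm2_ge0 // mulr_ge0 // ltW // conf_gt0. Qed.

Lemma disp_mulK x y : disp x y * (conf x * conf y) = enorm2 (val x - val y).
Proof. by rewrite divfK // mulf_neq0 // gt_eqF // conf_gt0. Qed.

Lemma hdistE x y : hdist x y = arcosh (1 + 2 * disp x y).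
Proof. by rewrite /hdist /disp mulrA. Qed.

Lemma hdistC x y : hdist x y = hdist y x.
Proof. by rewrite !hdistE /disp enorm2_distC [conf y * _]mulrC. Qed.

Lemma expR_arcosh (u : R) : 1 <= u -> expR (arcosh u) = u + Num.sqrt (u ^+ 2 - 1).
Proof.
by move=> u1; rewrite lnK // posrE ltr_wpDr ?sqrtr_ge0 // (lt_le_trans ltr01).
Qed.

(** A left inverse is cosh: with e = exp(arcosh w), one has w = (e^2 + 1) / (2 e). *)
Lemma arcosh_inj (u v : R) : 1 <= u -> 1 <= v -> arcosh u = arcosh v -> u = v.
Proof.
have coshE (w : R) : 1 <= w ->
    w = (expR (arcosh w) ^+ 2 + 1) / (2 * expR (arcosh w)).
  move=> w1; have := expR_arcosh w w1; set e := expR _; set s := Num.sqrt _ => ew.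
  have s2 : s ^+ 2 = w ^+ 2 - 1 by rewrite sqr_sqrtr // subr_ge0 exprn_ege1.
  apply: (canRL (mulfK _)); first by rewrite mulf_neq0 // gt_eqF // expR_gt0.
  by rewrite ew sqrrD s2; ring.
by move=> u1 v1 uv; rewrite [LHS](coshE u u1) [RHS](coshE v v1) uv.
Qed.

(** The left side is cosh d for d = [hdist x y], and cosh d <= exp d when d >= 0. *)
Lemma disp_le_expR x y : 1 + 2 * disp x y <= expR (hdist x y).
Proof.
have D0 := disp_ge0 x y.
by rewrite hdistE expR_arcosh ?lerDl ?sqrtr_ge0 // mulr_ge0.
Qed.

Lemma hdist_ge0 x y : 0 <= hdist x y.
Proof.
rewrite -ler_expR expR0; apply: le_trans (disp_le_expR x y).
by rewrite lerDl mulr_ge0 // disp_ge0.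
Qed.

(** By the triangle inequality it is enough to bound |x - y| by (1 + 8 [disp x y]) |y - z|. Since
    |z| = 1, the distance |y - z| is at least 1 - |y|, so a bound by a multiple of 1 - |y|
    suffices. *)
Lemma enorm_boundary_le x y (z : 'rV[R]_3) : enorm z = 1 ->
  enorm (val x - z) <= (2 + 8 * disp x y) * enorm (val y - z).
Proof.
move=> z1; set d := enorm (val x - val y).
have d0 : 0 <= d := enorm_ge0 _.
have xz : enorm (val x - z) <= d + enorm (val y - z) := enormB_le _ _ _.
have yz : 1 - enorm (val y) <= enorm (val y - z).
  have := enorm_le_dist z (val y); rewrite z1 enorm_distC.
  by rewrite lerBlDr.
have yx : 1 - enorm (val x) <= 1 - enorm (val y) + d.
  have := enorm_le_dist (val y) (val x); rewrite enorm_distC -/d; lra.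
have D0 := disp_ge0 x y.
have dD : d ^+ 2 <= 4 * disp x y * ((1 - enorm (val x)) * (1 - enorm (val y))).
  rewrite sqr_enorm -disp_mulK !confE.
  have := H3_enorm x; have := H3_enorm y.
  have := enorm_ge0 (val x); have := enorm_ge0 (val y).
  move: (enorm (val x)) (enorm (val y)) => a b b0 a0 b1 a1.
  have -> : disp x y * ((1 - a) * (1 + a) * ((1 - b) * (1 + b)))
     = disp x y * ((1 - a) * (1 - b)) * ((1 + a) * (1 + b)) by ring.
  have -> : 4 * disp x y * ((1 - a) * (1 - b))
     = disp x y * ((1 - a) * (1 - b)) * 4 by ring.
  (* What remains is (1 + a)(1 + b) <= 4, as both norms are below 1. *)
  rewrite ler_wpM2l //.
    by rewrite mulr_ge0 // mulr_ge0 // subr_ge0 ltW.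
  nra.
move: (disp x y) D0 dD => D D0 dD.
have a0 : 0 < 1 - enorm (val x) by rewrite subr_gt0 H3_enorm.
have b0 : 0 < 1 - enorm (val y) by rewrite subr_gt0 H3_enorm.
move: (1 - enorm (val x)) (1 - enorm (val y)) a0 b0 yz yx dD => a b a0 b0 yz yx dD.
(* If d > b, then a <= b + d <= 2 d, so d^2 <= 4 D a b <= 8 D b d, and one factor d cancels. *)
have dle : d <= (1 + 8 * D) * b.
  have [db|bd] := leP d b; first by nra.
  have : d * d <= 8 * D * b * d.
    rewrite -expr2; apply: le_trans dD _.
    have -> : 4 * D * (a * b) = (4 * D * b) * a by ring.
    have -> : 8 * D * b * d = (4 * D * b) * (2 * d) by ring.
    by apply: ler_wpM2l; [rewrite !mulr_ge0 // ltW|lra].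
  rewrite ler_pM2r; last exact: lt_trans bd.
  by nra.
have : (1 + 8 * D) * b <= (1 + 8 * D) * enorm (val y - z).
  by rewrite ler_wpM2l //; nra.
by nra.
Qed.

(** The factor 2 + 8 [disp x y] is at most 4 exp(d), because 1 + 2 [disp x y] <= exp(d); squaring
    gives the constant 16 exp(2d). *)
Lemma enorm2_boundary_le x y (z : 'rV[R]_3) : enorm z = 1 ->
  enorm2 (val x - z) <= 16 * expR (2 * hdist x y) * enorm2 (val y - z).
Proof.
move=> z1; have := enorm_boundary_le x y z z1; have := disp_le_expR x y.
rewrite -!sqr_enorm [2 * hdist x y]mulr_natl mulr2n expRD.
move: (enorm_ge0 (val x - z)) (enorm_ge0 (val y - z)) (disp_ge0 x y).
move: (enorm _) (enorm _) (disp _ _) (expR _) => q p D e p0 q0 D0 De pq.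
have pe : p <= 4 * e * q by apply: le_trans pq _; rewrite ler_wpM2r //; lra.
have -> : 16 * (e * e) * q ^+ 2 = (4 * e * q) ^+ 2 by ring.
by rewrite ler_pXn2r // nnegrE (le_trans p0 pe).
Qed.

Lemma isometry_disp (g : H3 R -> H3 R) x y :
  hisometry g -> disp (g x) (g y) = disp x y.
Proof.
move=> /(_ x y); rewrite !hdistE => /arcosh_inj gxy.
have : 1 + 2 * disp (g x) (g y) = 1 + 2 * disp x y.
  by apply: gxy; rewrite lerDl mulr_ge0 // disp_ge0.
by lra.
Qed.

(** This is the distortion law of Möbius maps, with [conf (g x) / conf x] as the scaling factor at
    [x]. Each factor depends on one point only, so all of them cancel in a cross ratio. *)
Lemma isometry_enorm2 (g : H3 R -> H3 R) x y : hisometry g ->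
  enorm2 (val (g x) - val (g y))
    = enorm2 (val x - val y) * (conf (g x) / conf x) * (conf (g y) / conf y).
Proof.
move=> /isometry_disp gd; rewrite -!disp_mulK gd.
by field; rewrite !gt_eqF // conf_gt0.
Qed.

End hyperbolic_distance.

(** * Topology of the ball and continuity of isometries *)

Section ball_topology.
Context {R : realType}.
Implicit Types x y : H3 R.

Lemma continuous_val (A : set 'rV[R]_3) : continuous (val : A -> 'rV[R]_3).
Proof. exact: initial_continuous. Qed.

Lemma continuous_conf : continuous (@conf R).
Proof.
move=> x; apply: (@cvgB R R^o (H3 R) (nbhs x) _ (cst 1)).
  exact: (@cvg_cst R^o).
apply: (@continuous_cvg _ _ _ (nbhs x) _ val); first exact: continuous_enorm2.
exact: continuous_val.
Qed.

Lemma cvg_disp {T : Type} {F : set_system T} {FF : Filter F}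
    (f g : T -> H3 R) x y :
  f t @[t --> F] --> x -> g t @[t --> F] --> y ->
  disp (f t) (g t) @[t --> F] --> disp x y.
Proof.
move=> fx gy; apply: cvgM.
  apply: (@cvg_enorm2B R T F FF (val \o f) (val \o g)).
    by apply: (@continuous_cvg _ _ _ F FF f val); [exact: continuous_val|].
  by apply: (@continuous_cvg _ _ _ F FF g val); [exact: continuous_val|].
apply: cvgV; first by rewrite mulf_neq0 // gt_eqF // conf_gt0.
by apply: cvgM; apply: continuous_cvg => //; exact: continuous_conf.
Qed.

Lemma disp_eq0 x y : disp x y = 0 -> x = y.
Proof.
move=> xy0; apply: val_inj; apply/eqP; rewrite -subr_eq0; apply/eqP.
by apply: enorm2_eq0; rewrite -disp_mulK xy0 mul0r.
Qed.

Lemma dispxx x : disp x x = 0.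
Proof. by rewrite /disp subrr enorm2E !mxE; ring. Qed.

Lemma squeeze_enorm2 {T : Type} {F : set_system T} {FF : Filter F}
    (f : T -> 'rV[R]_3) (a : 'rV[R]_3) (b : T -> R) :
  (forall t, enorm2 (a - f t) <= b t) -> b t @[t --> F] --> (0 : R) ->
  f t @[t --> F] --> a.
Proof.
move=> fab b0; apply/cvg_ballP => e e0.
have e20 : 0 < e ^+ 2 by rewrite exprn_gt0.
have := @cvgr_lt R T F FF b _ b0 _ e20.
apply: filterS => t bte; split=> // i j.
rewrite (ord1 i) /ball /= -(@ltr_pXn2r _ 2) ?nnegrE ?(ltW e0) //.
rewrite real_normK ?num_real //; apply: le_lt_trans bte; apply: le_trans (fab t).
rewrite /enorm2 (bigD1 j) //= !mxE lerDl.
by apply: sumr_ge0 => k _; exact: sqr_ge0.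
Qed.

(** Since [conf] is at most 1, |g x - g y|^2 is at most [disp (g x) (g y)] = [disp x y], which tends
    to 0 as y tends to x. *)
Lemma isometry_continuous (g : H3 R -> H3 R) : hisometry g -> continuous g.
Proof.
move=> gi; apply: continuous_comp_initial => x.
apply: (@squeeze_enorm2 _ (nbhs x) (nbhs_filter x) (val \o g) _ (disp x)).
  move=> y /=; rewrite -disp_mulK isometry_disp //.
  by rewrite ler_piMr ?disp_ge0 // mulr_ile1 ?conf_le1 // ltW // conf_gt0.
rewrite -(dispxx x).
apply: (@cvg_disp _ (nbhs x) (nbhs_filter x) (cst x) id); first exact: cst_continuous.
exact: cvg_id.
Qed.

End ball_topology.

(** * Deck transformations: uniqueness of lifts, and uniformity over the compact quotient *)

Section quotient.
Context {R : realType}.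

Lemma closed_coincidence (f h : R -> H3 R) :
  continuous f -> continuous h -> closed [set t | f t = h t].
Proof.
move=> cf ch.
have -> : [set t | f t = h t] = (fun t => disp (f t) (h t)) @^-1` [set 0].
  by apply/seteqP; split=> t /=; [move=> ->; rewrite dispxx|exact: disp_eq0].
apply: (iffLR (continuous_closedP _)); last exact: closed_eq.
move=> t; apply: (@cvg_disp R R (nbhs t) (nbhs_filter t) f h); [exact: cf|exact: ch].
Qed.

(** The coincidence set of the two paths is closed and contains 0, so by connectedness of the line
    it is enough that it be open. Near a coincidence time only finitely many deck transformations
    can relate the paths; the nontrivial ones are excluded at that time by freeness, hence also
    nearby. *)
Lemma lift_unique (G : set (H3 R -> H3 R)) (a b : R -> H3 R) :
  isometry_group G -> acts_freely G -> acts_properly_discontinuously G ->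
  continuous a -> continuous b -> a 0 = b 0 ->
  (forall t, exists2 g, G g & g (a t) = b t) -> a =1 b.
Proof.
move=> isoG freeG discG ca cb ab0 abG.
have connR : connected [set: R] by apply/connected_intervalP.
suff oE : open [set t | a t = b t].
  move=> t; suff EE : [set t | a t = b t] = setT.
    by have : [set t | a t = b t] t by rewrite EE.
  apply: connR; first by exists 0.
    by exists [set t | a t = b t] => //; rewrite setTI.
  by exists [set t | a t = b t]; [exact: closed_coincidence|rewrite setTI].
rewrite openE => t0 /= abt0.
pose I := `[t0 - 1, t0 + 1]%classic.
pose K := a @` I `|` b @` I.
have cK : compact K.
  by apply: compactU; apply: continuous_compact;
    [exact: continuous_subspaceT|exact: segment_compact
    |exact: continuous_subspaceT|exact: segment_compact].
have finG := discG K cK.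
(* The finitely many nontrivial elements that could carry [a t] to [b t] for some [t] in [I]. *)
pose F := [set g | G g /\ (g @` K) `&` K !=set0] `\ id.
have finF : finite_set F by exact: finite_setD.
have closedF : closed (\bigcup_(g in F) [set t | g (a t) = b t]).
  apply: closed_bigcup => // g [[Gg _] _].
  apply: closed_coincidence => // t; apply: continuous_comp; first exact: ca.
  by apply: isometry_continuous; exact: (isometry_group_isom isoG Gg).
have t0F : (~` \bigcup_(g in F) [set t | g (a t) = b t]) t0.
  move=> [g [[Gg _] gid]] /= gab; apply: gid; apply: (freeG _ (a t0)) => //.
  by rewrite gab abt0.
have : nbhs t0 (~` \bigcup_(g in F) [set t | g (a t) = b t]).
  by apply: open_nbhs_nbhs; split=> //; exact: closed_openC.
have : nbhs t0 I.
  apply: filterS (@nbhsx_ballx R R^o t0 1 ltr01) => t.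
  rewrite /ball /= ltr_distlC => /andP[lo hi].
  by rewrite /I /= in_itv /= (ltW lo) (ltW hi).
apply: filterS2 => t It tF /=.
have [g Gg gab] := abG t.
have [gid|gNid] := pselect (g = id); first by rewrite -gab gid.
exfalso; apply: tF; exists g => //; split=> //; split=> //.
exists (b t); split; last by right; exists t.
by exists (a t) => //; left; exists t.
Qed.

Context (M : topologicalType) (G : set (H3 R -> H3 R)) (proj : H3 R -> M).
Context (hM : closed_hyperbolic_3manifold G proj).

(** Both sides, as paths in [t], start at [g x] and project to the same orbit in [M], so uniqueness
    of lifts applies. *)
Lemma lifted_flow_equivariant (Phi : R -> M -> M) (tPhi : R -> H3 R -> H3 R) :
  continuous_action tPhi ->
  (forall t x, proj (tPhi t x) = Phi t (proj x)) ->
  forall g, G g -> forall t x, tPhi t (g x) = g (tPhi t x).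
Proof.
move=> [ctPhi tPhi0 tPhiD] tPhiP g Gg t x.
have cflow y : continuous (tPhi ^~ y).
  move=> s; apply: (@continuous_comp _ _ _ (fun s => (s, y)) (fun p => tPhi p.1 p.2)).
    apply: (@cvg_pair _ _ _ (nbhs s) (nbhs s) (nbhs y) _ _ _ id (cst y)).
      exact: cvg_id.
    exact: (@cst_continuous R).
  exact: ctPhi.
apply: (@lift_unique G (tPhi ^~ (g x)) (g \o tPhi ^~ x)).
- exact: ch3_group hM.
- exact: ch3_free hM.
- exact: ch3_proper hM.
- exact: cflow.
- move=> s; apply: continuous_comp; first exact: cflow.
  by apply: isometry_continuous; exact: (isometry_group_isom (ch3_group hM) Gg).
- by rewrite /= !tPhi0.
- move=> s; apply/(ch3_fiber hM).
  have projG y : proj (g y) = proj y by apply/esym/(ch3_fiber hM); exists g.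
  by rewrite /= projG !tPhiP projG.
Qed.

(** The saturation of [U] is a union of preimages of [U] under elements of [G], which are
    continuous. *)
Lemma proj_open (U : set (H3 R)) : open U -> open (proj @` U).
Proof.
move=> oU; apply/(ch3_quotient hM).
have -> : proj @^-1` (proj @` U) = \bigcup_(g in G) g @^-1` U.
  apply/seteqP; split=> [x [u Uu] /esym /(ch3_fiber hM) [g Gg gxu]|x [g Gg Ugx]].
    by exists g => //=; rewrite gxu.
  by exists (g x) => //; apply/esym/(ch3_fiber hM); exists g.
apply: bigcup_open => g Gg; apply: open_comp => // x _.
by apply: isometry_continuous; exact: (isometry_group_isom (ch3_group hM) Gg).
Qed.

(** This is the only way cocompactness enters the estimates: a [G]-invariant property that holds
    locally uniformly for large [T] descends to [M], where compactness makes the threshold on [T]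
    uniform. *)
Lemma near_pinfty_cocompact (P : R -> H3 R -> Prop) :
  (forall g, G g -> forall T x, P T x -> P T (g x)) ->
  (forall x : H3 R, \forall y \near nbhs x & T \near pinfty_nbhs R, P T y) ->
  \forall T \near pinfty_nbhs R, forall x, P T x.
Proof.
move=> PG Pnear.
have cov := iffLR (compact_near_coveringP _) (ch3_compact hM).
pose Q (T : R) (m : M) := forall x, proj x = m -> P T x.
have : \forall T \near pinfty_nbhs R, [set: M] `<=` Q T.
  apply: cov => m _; have [x0 x0m] := ch3_surj hM m.
  have [[U V] /= [Ux0 Voo] UVP] := Pnear x0.
  exists (proj @` U^°, V) => /=; last first.
    move=> [m' T] /= [[u Uu <-] VT] x /esym /(ch3_fiber hM) [g Gg <-].
    by apply: PG => //; apply: (UVP (u, T)); split=> //; exact: interior_subset.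
  split=> //; apply: open_nbhs_nbhs; split; last by exists x0.
  by apply: proj_open; exact: open_interior.
by apply: filterS => T QT x; exact: QT.
Qed.

End quotient.

(** Jumps are concatenated until at most [T0] of the time is left, and [short] controls that
    remainder. Here [n] counts the jumps; each lasts at most [T0], and the remainder accounts for
    the extra 1 in [n.+1]. *)
Lemma linear_growth {R : realType} {T : Type} (phi : R -> T -> T) (r : T -> R)
    (T0 c : R) :
  0 <= T0 -> 0 < c ->
  (forall s t x, phi (s + t) x = phi s (phi t x)) ->
  (forall x, exists2 t, 1 <= t <= T0 & expR 1 * r x <= r (phi t x)) ->
  (forall x t, 0 <= t <= T0 -> r x <= c * r (phi t x)) ->
  forall x t, 0 <= t ->
    exists n : nat, t <= n.+1%:R * T0 /\ expR n%:R * r x <= c * r (phi t x).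
Proof.
move=> T00 c0 phiD jump short x t t0.
have [N tN] : exists N : nat, t <= N%:R.
  by exists (Num.bound t); rewrite ltW // archi_boundP.
(* A jump lasts at least 1, so it lowers the integer bound [N] on the remaining time by one. *)
elim: N x t t0 tN => [|N IH] x t t0 tN.
  exists 0%N; rewrite expR0 !mul1r.
  have -> : t = 0 by apply/eqP; rewrite eq_le t0 tN.
  by split=> //; apply: short; rewrite lexx.
have [tT0|T0t] := leP t T0.
  by exists 0%N; rewrite expR0 !mul1r; split=> //; apply: short; rewrite t0.
have [t1 /andP[t1_ge1 t1T0] rt1] := jump x.
have t1t : 0 <= t - t1 by rewrite subr_ge0 (le_trans t1T0) // ltW.
have tt1N : t - t1 <= N%:R by move: tN; rewrite -natr1; lra.
have [n [tn rn]] := IH (phi t1 x) (t - t1) t1t tt1N.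
exists n.+1; split.
  by move: tn; rewrite -!natr1; lra.
move: rn; rewrite -phiD subrK; apply: le_trans.
by rewrite -natr1 expRD -mulrA ler_pM2l // expR_gt0.
Qed.

(** * The endpoint ratio: divergence along orbits, deck invariance and comparison with distance *)

Section endpoint_ratio.
Context {R : realType}.
Context (tPhi : R -> H3 R -> H3 R) (eta_p eta_m : H3 R -> S2inf R).
Context (actPhi : continuous_action tPhi).
Context (lim_p : forall x : H3 R, val (tPhi t x) @[t --> +oo] --> val (eta_p x)).
Context (lim_m : forall x : H3 R, val (tPhi t x) @[t --> -oo] --> val (eta_m x)).
Context (eta_neq : forall x : H3 R, eta_p x <> eta_m x).
Context (eta_p_cont : continuous eta_p) (eta_m_cont : continuous eta_m).

(** Its logarithm is the difference of the Busemann functions at the two ends, normalized at the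
    origin; the factors 1 - |x|^2 of the two Poisson kernels cancel. *)
Definition endpoint_ratio (x : H3 R) : R :=
  enorm2 (val x - val (eta_m x)) / enorm2 (val x - val (eta_p x)).

Lemma S2inf_enorm (z : S2inf R) : enorm (val z) = 1.
Proof. exact: set_mem (valP z). Qed.

Lemma enorm2_inner_boundary_gt0 (x : H3 R) (z : S2inf R) :
  0 < enorm2 (val x - val z).
Proof.
apply: enorm2_gt0; rewrite subr_eq0; apply/eqP => xz.
by have := H3_enorm x; rewrite xz S2inf_enorm ltxx.
Qed.

Lemma endpoint_ratio_gt0 x : 0 < endpoint_ratio x.
Proof. by rewrite divr_gt0 // enorm2_inner_boundary_gt0. Qed.

Lemma eta_p_invariant s x : eta_p (tPhi s x) = eta_p x.
Proof.
have shifted : val (tPhi t (tPhi s x)) @[t --> +oo] --> val (eta_p x).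
  rewrite (_ : (fun t => _) = fun t => val (tPhi (t + s) x)); last first.
    by apply/funext => t; rewrite (action_D actPhi).
  by rewrite (cvg_shiftr s (fun t => val (tPhi t x))); exact: lim_p.
apply: val_inj.
exact: (@cvg_unique _ (@norm_hausdorff R 'rV[R]_3) _ _ _ _ (lim_p _) shifted).
Qed.

(** In this form the limits at both ends of an orbit are taken along the same filter, so they can be
    combined in a single expression. *)
Lemma lim_m_opp x : val (tPhi (- t) x) @[t --> +oo] --> val (eta_m x).
Proof. exact: (iffLR (cvgNy_compNP (fun t => val (tPhi t x)) _)). Qed.

Lemma eta_m_invariant s x : eta_m (tPhi s x) = eta_m x.
Proof.
have shifted : val (tPhi (- t) (tPhi s x)) @[t --> +oo] --> val (eta_m x).
  rewrite (_ : (fun t => _) = fun t => val (tPhi (- (t - s)) x)); last first.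
    by apply/funext => t; rewrite -(action_D actPhi) opprB addrC.
  rewrite (cvg_shiftr (- s) (fun t => val (tPhi (- t) x))); exact: lim_m_opp.
apply: val_inj.
exact: (@cvg_unique _ (@norm_hausdorff R 'rV[R]_3) _ _ _ _ (lim_m_opp _) shifted).
Qed.

Lemma continuous_endpoint_ratio : continuous endpoint_ratio.
Proof.
have cN (eta : H3 R -> S2inf R) : continuous eta ->
    continuous (fun x : H3 R => enorm2 (val x - val (eta x))).
  move=> ceta x; apply: (@cvg_enorm2B R _ (nbhs x) (nbhs_filter x) val (val \o eta)).
    exact: continuous_val.
  by apply: (@continuous_comp _ _ _ eta val); [exact: ceta|exact: continuous_val].
move=> x; apply: (@cvgM R _ (nbhs x)); first exact: cN.
apply: (@cvgV R _ (nbhs x)); last exact: cN.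
by rewrite gt_eqF // enorm2_inner_boundary_gt0.
Qed.

(** Along the orbit the numerator tends to |eta_+ - eta_-|^2 > 0 and the denominator to 0. The limit
    is taken of [num t - A * den t], which avoids dividing by a vanishing quantity. *)
Lemma endpoint_ratio_gt_near x A :
  \forall t \near pinfty_nbhs R, A < endpoint_ratio (tPhi t x).
Proof.
pose num t := enorm2 (val (tPhi t x) - val (eta_m x)).
pose den t := enorm2 (val (tPhi t x) - val (eta_p x)).
have cnum : num t @[t --> +oo] --> enorm2 (val (eta_p x) - val (eta_m x)).
  by apply: cvg_enorm2B; [exact: lim_p|exact: cvg_cst].
have cden : den t @[t --> +oo] --> enorm2 (val (eta_p x) - val (eta_p x)).
  by apply: cvg_enorm2B; [exact: lim_p|exact: cvg_cst].
have cdiff : num t - A * den t @[t --> +oo] -->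
    enorm2 (val (eta_p x) - val (eta_m x)) - A * enorm2 (val (eta_p x) - val (eta_p x)).
  by apply: cvgB => //; apply: cvgM => //; exact: cvg_cst.
have : \forall t \near pinfty_nbhs R, 0 < num t - A * den t.
  apply: (@cvgr_gt R _ (pinfty_nbhs R) _ _ _ cdiff).
  rewrite subrr (_ : enorm2 0 = 0) ?mulr0 ?subr0; last first.
    by rewrite enorm2E !mxE expr0n /= !addr0.
  apply: enorm2_gt0; rewrite subr_eq0; apply/eqP => e.
  exact: (eta_neq x (val_inj e)).
apply: filterS => t; rewrite subr_gt0 /endpoint_ratio eta_p_invariant eta_m_invariant.
by rewrite ltr_pdivlMr // enorm2_inner_boundary_gt0.
Qed.

(* The displacement identity [isometry_enorm2] makes the cross ratio of four
   points of H^3 invariant; let two of them run to the ends of the orbit. *)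
Lemma endpoint_ratio_cocycle_invariant (g : H3 R -> H3 R) t x :
  hisometry g -> (forall s y, tPhi s (g y) = g (tPhi s y)) ->
  endpoint_ratio (tPhi t (g x)) * endpoint_ratio x
    = endpoint_ratio (tPhi t x) * endpoint_ratio (g x).
Proof.
move=> gi gPhi.
pose N (a b : 'rV[R]_3) := enorm2 (a - b).
pose y := tPhi t x.
(* Equality of the cross ratios of [y], [x], [z], [w] and of their images, cleared of denominators.
   Later [z] runs to the backward end and [w] to the forward end of the orbit. *)
have cross z w : N (val (g y)) (val (g z)) * N (val (g x)) (val (g w))
      * (N (val y) (val w) * N (val x) (val z))
    = N (val (g y)) (val (g w)) * N (val (g x)) (val (g z))
      * (N (val y) (val z) * N (val x) (val w)).
  by rewrite /N !(isometry_enorm2 g) //; ring.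
have cN (a : 'rV[R]_3) (f : R -> H3 R) (b : 'rV[R]_3) :
    val (f s) @[s --> +oo] --> b -> N a (val (f s)) @[s --> +oo] --> N a b.
  by move=> fb; apply: cvg_enorm2B => //; exact: cvg_cst.
have lp := lim_p x; have lm := lim_m_opp x.
have lgp : val (g (tPhi s x)) @[s --> +oo] --> val (eta_p (g x)).
  by under eq_fun do rewrite -gPhi; exact: lim_p.
have lgm : val (g (tPhi (- s) x)) @[s --> +oo] --> val (eta_m (g x)).
  by under eq_fun do rewrite -gPhi; exact: lim_m_opp.
pose F s := N (val (g y)) (val (g (tPhi (- s) x))) * N (val (g x)) (val (g (tPhi s x)))
  * (N (val y) (val (tPhi s x)) * N (val x) (val (tPhi (- s) x))).
have FE : F = fun s =>
    N (val (g y)) (val (g (tPhi s x))) * N (val (g x)) (val (g (tPhi (- s) x)))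
    * (N (val y) (val (tPhi (- s) x)) * N (val x) (val (tPhi s x))).
  by apply/funext => s; exact: cross.
have key : N (val (g y)) (val (eta_m (g x))) * N (val (g x)) (val (eta_p (g x)))
      * (N (val y) (val (eta_p x)) * N (val x) (val (eta_m x)))
    = N (val (g y)) (val (eta_p (g x))) * N (val (g x)) (val (eta_m (g x)))
      * (N (val y) (val (eta_m x)) * N (val x) (val (eta_p x))).
  apply: (@cvg_unique _ (@norm_hausdorff R R^o) (F s @[s --> +oo])).
    by apply: cvgM; apply: cvgM; exact: cN.
  by rewrite FE; apply: cvgM; apply: cvgM; exact: cN.
rewrite gPhi /endpoint_ratio -gPhi !eta_p_invariant !eta_m_invariant gPhi -/y.
have nz a z : enorm2 (val a - val z) != 0 := lt0r_neq0 (enorm2_inner_boundary_gt0 a z).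
rewrite !mulf_div; apply/eqP; rewrite eqr_div ?mulf_neq0 ?nz //.
have shuffle (a b c d e f h i : R) :
    a * b * (c * d) = e * f * (h * i) -> a * d * (c * b) = h * f * (e * i).
  move=> E; have -> : a * d * (c * b) = a * b * (c * d) by ring.
  by rewrite E; ring.
by apply/eqP; exact: shuffle key.
Qed.

(** The endpoints are the same at both times, so numerator and denominator each change by a factor
    of at most 16 exp(2d); the product of the two bounds is 256 exp(4d). *)
Lemma endpoint_ratio_le s t x :
  endpoint_ratio (tPhi t x)
    <= 256 * expR (4 * hdist (tPhi s x) (tPhi t x)) * endpoint_ratio (tPhi s x).
Proof.
rewrite /endpoint_ratio !eta_p_invariant !eta_m_invariant.
have := enorm2_boundary_le (tPhi t x) (tPhi s x) _ (S2inf_enorm (eta_m x)).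
have := enorm2_boundary_le (tPhi s x) (tPhi t x) _ (S2inf_enorm (eta_p x)).
rewrite [hdist (tPhi t x) _]hdistC.
have -> : 4 * hdist (tPhi s x) (tPhi t x)
    = 2 * hdist (tPhi s x) (tPhi t x) + 2 * hdist (tPhi s x) (tPhi t x) by ring.
rewrite expRD; move: (expR_gt0 (2 * hdist (tPhi s x) (tPhi t x))).
move: (enorm2_inner_boundary_gt0 (tPhi t x) (eta_m x)).
move: (enorm2_inner_boundary_gt0 (tPhi s x) (eta_m x)).
move: (enorm2_inner_boundary_gt0 (tPhi t x) (eta_p x)).
move: (enorm2_inner_boundary_gt0 (tPhi s x) (eta_p x)).
set a := enorm2 _; set b := enorm2 _; set c := enorm2 _; set d := enorm2 _.
set e := expR _; move=> a0 b0 c0 d0 e0 ab dc.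
rewrite ler_pdivrMr //.
have -> : 256 * (e * e) * (c / a) * b = 256 * (e * e) * c * b / a by ring.
rewrite ler_pdivlMr //.
have -> : 256 * (e * e) * c * b = 16 * e * c * (16 * e * b) by ring.
exact: ler_pM (ltW d0) (ltW a0) dc ab.
Qed.

End endpoint_ratio.

(** * Uniform constants from cocompactness, and the quasigeodesic inequality *)

Theorem theoremB (R : realType) (M : topologicalType)
    (G : set (H3 R -> H3 R)) (proj : H3 R -> M)
    (hM : closed_hyperbolic_3manifold G proj)
    (Phi : R -> M -> M) (tPhi : R -> H3 R -> H3 R) (X : H3 R -> 'rV[R]_3)
    (hPhi : flow_with_lift G proj Phi tPhi X)
    (harc : arc_length_parameterized X)
    (eta_p eta_m : H3 R -> S2inf R)
    (ha_p : forall x : H3 R, val (tPhi t x) @[t --> +oo] --> val (eta_p x))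
    (ha_m : forall x : H3 R, val (tPhi t x) @[t --> -oo] --> val (eta_m x))
    (hb : forall x : H3 R, eta_p x <> eta_m x)
    (hc_p : continuous eta_p)
    (hc_m : continuous eta_m) :
  quasigeodesic tPhi.
Proof.
have act := flow_lift_action hPhi.
have equiv := lifted_flow_equivariant _ _ _ hM _ _ act (flow_lift hPhi).
set r := endpoint_ratio eta_p eta_m.
have r0 : forall x, 0 < r x := endpoint_ratio_gt0 _ _.
have rcont : continuous r by exact: continuous_endpoint_ratio.
have rtoinf x A : \forall t \near pinfty_nbhs R, A < r (tPhi t x).
  exact: endpoint_ratio_gt_near.
have rG g t x : G g -> r (tPhi t (g x)) = r (tPhi t x) * r (g x) / r x.
  move=> Gg; apply: (canRL (mulfK (lt0r_neq0 (r0 x)))).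
  apply: endpoint_ratio_cocycle_invariant => //.
    exact: (isometry_group_isom (ch3_group hM) Gg).
  by move=> s y; exact: equiv.
have rPhi_cont : continuous (fun p : R * H3 R => r (tPhi p.1 p.2)).
  move=> p; apply: (@continuous_comp _ _ _ (fun p => tPhi p.1 p.2) r).
    exact: (action_continuous act).
  exact: rcont.
(* Divergence of [r] gives each point a jump time at least 1. The jump inequality is strict there,
   so the same time serves nearby points; invariance of the quotient of [r] then makes the bound on
   jump times uniform. *)
have [T0 T0_ge0 jump] : exists2 T0 : R, 0 <= T0 &
    forall x, exists2 t, 1 <= t <= T0 & expR 1 * r x <= r (tPhi t x).
  pose P T x := exists2 t, 1 <= t <= T & expR 1 * r x <= r (tPhi t x).
  have nearP : \forall T \near pinfty_nbhs R, forall x, P T x.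
    apply: (near_pinfty_cocompact _ _ _ hM) => [g Gg T x [t tT rt]|x].
      exists t => //; rewrite rG // ler_pdivlMr // mulrAC ler_pM2r //.
    have [t [t1 rt]] : exists t : R, 1 <= t /\ expR 1 * r x < r (tPhi t x).
      have both : \forall t \near pinfty_nbhs R, 1 <= t /\ expR 1 * r x < r (tPhi t x).
        by apply: filterI; [exact: nbhs_pinfty_ge (num_real _)|exact: rtoinf].
      exact: (filter_ex both).
    have cdiff : (fun y : H3 R => r (tPhi t y) - expR 1 * r y) @ x -->
        r (tPhi t x) - expR 1 * r x.
      apply: (@cvgB R R^o _ (nbhs x)).
        apply: (@continuous_comp _ _ _ (fun y => (t, y)) (fun p => r (tPhi p.1 p.2))).
          apply: (@cvg_pair _ _ _ (nbhs x) (nbhs t) (nbhs x) _ _ _ (cst t) id).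
            exact: (@cst_continuous (H3 R)).
          exact: cvg_id.
        exact: rPhi_cont.
      by apply: (@cvgM R _ (nbhs x)); [exact: (@cst_continuous (H3 R))|exact: rcont].
    have nearx : \forall y \near nbhs x, 0 < r (tPhi t y) - expR 1 * r y.
      by apply: (@cvgr_gt R _ (nbhs x) _ _ _ cdiff); rewrite subr_gt0.
    exists ([set y | 0 < r (tPhi t y) - expR 1 * r y], [set T | t <= T]) => /=.
      by split; [exact: nearx|exact: nbhs_pinfty_ge (num_real _)].
    move=> [y T] /= [ry tT]; exists t; first by rewrite t1.
    by rewrite ltW // -subr_gt0.
  have [T0 [T00 PT0]] : exists T, 0 <= T /\ forall x, P T x.
    have both : \forall T \near pinfty_nbhs R, 0 <= T /\ forall x, P T x.
      by apply: filterI; [exact: nbhs_pinfty_ge (num_real _)|exact: nearP].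
    exact: (filter_ex both).
  by exists T0.
have [c c0 short] : exists2 c : R, 0 < c &
    forall x t, 0 <= t <= T0 -> r x <= c * r (tPhi t x).
  pose P c x := forall t, 0 <= t <= T0 -> r x <= c * r (tPhi t x).
  have nearP : \forall c \near pinfty_nbhs R, forall x, P c x.
    apply: (near_pinfty_cocompact _ _ _ hM) => [g Gg c x Pc t tT|x].
      rewrite rG // mulrA ler_pdivlMr // mulrC mulrA ler_pM2r //.
      exact: Pc.
    have cov := iffLR (compact_near_coveringP _) (@segment_compact R 0 T0).
    pose F := filter_prod (nbhs x) (pinfty_nbhs R).
    have FF : Filter F by exact: filter_prod_filter.
    (* A second covering argument, now over the times in [[0, T0]], with the point [y] near [x] and
       the large constant [c] as joint parameter. *)
    pose Q (yc : H3 R * R) t := r yc.1 <= yc.2 * r (tPhi t yc.1).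
    suff nearQ : \near F, `[0, T0]%classic `<=` Q F.
      apply: (@filterS _ F FF _ _ _ nearQ) => -[y c] yc t tT.
      by apply: (yc t); rewrite /= in_itv.
    apply: cov => t _.
    have d0 : 0 < r (tPhi t x) / 2 by rewrite divr_gt0.
    have : \forall p \near nbhs (t, x), r (tPhi t x) / 2 < r (tPhi p.1 p.2).
      apply: (@cvgr_gt R _ (nbhs (t, x)) _ _ _ (rPhi_cont (t, x))) => /=.
      by rewrite ltr_pdivrMr // mulr_natr mulr2n ltrDl.
    move=> [[A B] /= [At Bx] AB].
    have Dx : \forall y \near nbhs x, r y < r x + 1.
      by apply: (@cvgr_lt R _ (nbhs x) _ _ _ (rcont x)); rewrite ltrDl.
    (* Near [(t, x)] the later value of [r] exceeds half its value there, and near [x] the initial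
       value is below [r x + 1]; [c0] is the quotient of these bounds. *)
    pose c0 := (r x + 1) / (r (tPhi t x) / 2).
    exists (A, (B `&` [set y | r y < r x + 1]) `*` [set c | c0 <= c]) => /=.
      split=> //; exists (B `&` [set y | r y < r x + 1], [set c | c0 <= c]) => //=.
      by split; [exact: filterI|exact: nbhs_pinfty_ge (num_real _)].
    move=> [t' [y c]] /= [At' [[By ry] cc]].
    have rt' := AB (t', y) (conj At' By).
    apply: le_trans (ltW ry) _.
    have -> : r x + 1 = c0 * (r (tPhi t x) / 2) by rewrite divfK // gt_eqF.
    have c0_ge0 : 0 <= c0 by rewrite divr_ge0 ?ltW // ltr_wpDl // ltW.
    by apply: ler_pM => //; rewrite ltW.
  have [c [c0 Pc]] : exists c, 0 < c /\ forall x, P c x.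
    have both : \forall c \near pinfty_nbhs R, 0 < c /\ forall x, P c x.
      by apply: filterI; [exact: nbhs_pinfty_gt (num_real _)|exact: nearP].
    exact: (filter_ex both).
  by exists c.
have growth := linear_growth tPhi r T0 c T0_ge0 c0 (action_D act) jump short.
(* With n jumps between the times, exp(n) r(s) <= c r(t) <= 256 c exp(4d) r(s), so n <= ln(256 c) +
   4 d, while t - s <= (n + 1) [T0]. *)
have bound x s t : s <= t ->
    t - s <= T0 * (4 * hdist (tPhi s x) (tPhi t x) + `|ln (c * 256)| + 1).
  move=> st; have := growth (tPhi s x) (t - s).
  rewrite subr_ge0 -(action_D act) subrK => /(_ st) [n [tsn rn]].
  have rle : r (tPhi t x) <= 256 * expR (4 * hdist (tPhi s x) (tPhi t x)) * r (tPhi s x).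
    exact: endpoint_ratio_le.
  have c256 : 0 < c * 256 by rewrite mulr_gt0.
  have : expR n%:R <= expR (ln (c * 256) + 4 * hdist (tPhi s x) (tPhi t x)).
    rewrite expRD lnK ?posrE // -(ler_pM2r (r0 (tPhi s x))).
    by apply: le_trans rn _; rewrite -!mulrA ler_pM2l // mulrA.
  rewrite ler_expR => nle; apply: le_trans tsn _; rewrite mulrC ler_wpM2l //.
  by have := ler_norm (ln (c * 256)); rewrite -[n.+1%:R]natr1; lra.
(* Large enough to dominate both the slope [4 T0] and the additive term [T0 (|ln (256 c)| + 1)]; the
   leading 1 ensures [1 <= k]. *)
pose k := 1 + T0 * (4 + `|ln (c * 256)| + 1).
have k1 : 1 <= k by rewrite lerDl mulr_ge0 // !addr_ge0.
exists k => // x s t.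
have final d D : 0 <= D -> d <= T0 * (4 * D + `|ln (c * 256)| + 1) -> d <= k * D + k.
  move=> D0 /le_trans; apply; rewrite /k.
  have := normr_ge0 (ln (c * 256)); move: `|_| => L L0.
  have : 0 <= T0 * D by rewrite mulr_ge0.
  have : 0 <= T0 * L by rewrite mulr_ge0.
  have : 0 <= T0 * L * D by rewrite !mulr_ge0.
  by clear -T0_ge0 D0; nra.
have [st|ts] := leP s t.
  rewrite ger0_norm ?subr_ge0 //; apply: final; first exact: hdist_ge0.
  exact: bound.
rewrite distrC hdistC ger0_norm ?subr_ge0 ?(ltW ts) //.
apply: final; first exact: hdist_ge0.
by apply: bound; exact: ltW.
Qed.
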